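(* Let $n\ge 1$, let $\pi$ be a permutation of $\{1,\dots,n\}$ all of whose cycles have length 1 or 2, and let $\rho=(n+1,\,n+2)$ be the transposition of $n+1$ and $n+2$. Let $\pi\circ\rho$ be the permutation of $\{1,\dots,n+2\}$ acting as $\pi$ on $\{1,\dots,n\}$ and as $\rho$ on $\{n+1,n+2\}$. For a function $f:B^{n+2}\to B$ and $a,b\in\{0,1\}$ let $f_{ab}:B^n\to B$ be the restriction $f_{ab}(x)=f(x_1,\dots,x_n,a,b)$. Then $f\in \mathrm{Fix}(\pi\circ\rho,D_{n+2})$ if and only if the following four conditions all hold: 1. $f_{00},f_{11}\in \mathrm{Fix}(\pi,D_n)$; 2. $f_{10},f_{01}\in D_n$; 3. $f_{10}=\pi(f_{01})$; 4. $f_{00}\le f_{10}$ and $f_{10}\le f_{11}$.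
   Context: $B=\{0,1\}$ with $0\le 1$, and $B^n$ is the set of functions $\{1,\dots,n\}\to B$ (equivalently, $n$-bit strings) with the componentwise order. $D_n$ is the set of monotone (order-preserving) functions $B^n\to B$, ordered pointwise: $g\le h$ iff $g(x)\le h(x)$ for all $x\in B^n$. A permutation $\sigma$ of $\{1,\dots,n\}$ acts on $B^n$ by $\sigma(x)=x\circ\sigma$, and acts on $D_n$ by $\sigma(g)=g\circ\sigma$, i.e. $\sigma(g)(x)=g(\sigma(x))$. $\mathrm{Fix}(\sigma,D_n)=\{g\in D_n:\sigma(g)=g\}$. *)

(* Defs.v *)
From mathcomp Require Import all_boot all_order all_fingroup.

Set Implicit Arguments.
Unset Strict Implicit.
Unset Printing Implicit Defensive.

(* Indices are shifted by one: the element i + 1 of {1, ..., n} is the element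
   i of 'I_n, so n + 1 and n + 2 are the elements n and n + 1 of 'I_(n + 2). *)
Notation bits n := {ffun 'I_n -> bool}.
Notation bfun n := {ffun bits n -> bool}.

(* Used both for the componentwise order of [bits n] (with T := 'I_n) and for
   the pointwise order of [bfun n] (with T := bits n); the order on bool is
   false <= true. *)
Definition ple (T : finType) (g h : {ffun T -> bool}) : bool :=
  [forall x, (g x <= h x)%O].

Definition Dn (n : nat) : {set bfun n} :=
  [set g : bfun n | [forall x, forall y, ple x y ==> (g x <= g y)%O]].

Definition act_bits (n : nat) (s : 'S_n) (x : bits n) : bits n :=
  [ffun i => x (s i)].

Definition act_bfun (n : nat) (s : 'S_n) (g : bfun n) : bfun n :=
  [ffun x => g (act_bits s x)].

Definition FixD (n : nat) (s : 'S_n) : {set bfun n} :=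
  [set g in Dn n | act_bfun s g == g].

(* The permutation of 'I_(m + n) acting as s on the first m indices and as t on
   the last n ones. *)
Definition juxt_fun (m n : nat) (s : 'S_m) (t : 'S_n) (i : 'I_(m + n)) :
    'I_(m + n) :=
  match split i with
  | inl j => lshift n (s j)
  | inr k => rshift m (t k)
  end.

Lemma juxt_fun_inj (m n : nat) (s : 'S_m) (t : 'S_n) :
  injective (juxt_fun s t).
Proof.
apply: (@can_inj _ _ _ (juxt_fun s^-1%g t^-1%g)) => i.
rewrite -[i in RHS]splitK /juxt_fun.
case: (split i) => j.
  by rewrite (unsplitK (inl (s j))) permK.
by rewrite (unsplitK (inr (t j))) permK.
Qed.

Definition juxt_perm (m n : nat) (s : 'S_m) (t : 'S_n) : 'S_(m + n) :=
  perm (@juxt_fun_inj m n s t).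

Definition swap2 : 'S_2 := tperm ord0 ord_max.

(* (x_1, ..., x_n, a, b) *)
Definition append2 (n : nat) (x : bits n) (a b : bool) : bits (n + 2) :=
  [ffun i => match split i with
             | inl j => x j
             | inr k => if k == ord0 then a else b
             end].

Definition restr2 (n : nat) (f : bfun (n + 2)) (a b : bool) : bfun n :=
  [ffun x => f (append2 x a b)].

(* Main.v *)
Require Import Defs.
From mathcomp Require Import all_boot all_order all_fingroup.
Import Order.POrderTheory.

(** A function on [B^(n+2)] is the same thing as its four restrictions
    [f_ab : B^n -> B], and both membership conditions translate to them.
    By [Dn_restr2P], [f] is monotone iff each [f_ab] is monotone and
    [f_ab <= f_cd] whenever [(a, b) <= (c, d)].  Since the permutation of
    [n + 2] indices applies [pi] to the first [n] bits and swaps the last two,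
    [f] is fixed iff [f_ab = pi (f_ba)] for all [a, b] ([fixed_restr2P]).

    The direct implication is then an instantiation.  The converse has to
    recover two kinds of facts about [f_01].  As all cycles of [pi] have length
    at most 2, [pi] acts on functions as an involution ([act_bfunK]), so
    [f_10 = pi (f_01)] also gives [f_01 = pi (f_10)].  As the action preserves
    the pointwise order ([act_bfun_homo]), applying [pi] to
    [f_00 <= f_10 <= f_11], whose outer terms are fixed, gives
    [f_00 <= f_01 <= f_11]. *)

Lemma pleP (T : finType) (g h : {ffun T -> bool}) :
  reflect (forall x, (g x <= h x)%O) (ple g h).
Proof. exact: forallP. Qed.

Lemma ple_refl (T : finType) (g : {ffun T -> bool}) : ple g g.
Proof. by apply/pleP. Qed.

Lemma ple_trans (T : finType) (g h k : {ffun T -> bool}) :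
  ple g h -> ple h k -> ple g k.
Proof.
by move=> /pleP gh /pleP hk; apply/pleP => x; apply: le_trans (hk x).
Qed.

Lemma DnP (n : nat) (g : bfun n) :
  reflect (forall x y, ple x y -> (g x <= g y)%O) (g \in Dn n).
Proof.
rewrite inE; apply: (iffP forallP) => [mono x y xy | mono x].
  by move/forallP/(_ y)/implyP: (mono x); apply.
by apply/forallP => y; apply/implyP; apply: mono.
Qed.

Lemma FixDP (n : nat) (s : 'S_n) (g : bfun n) :
  reflect (g \in Dn n /\ act_bfun s g = g) (g \in FixD s).
Proof. by apply: (iffP setIdP) => -[gD /eqP]. Qed.

Lemma act_bfun_homo (n : nat) (s : 'S_n) (g h : bfun n) :
  ple g h -> ple (act_bfun s g) (act_bfun s h).
Proof. by move=> /pleP gh; apply/pleP => x; rewrite !ffunE. Qed.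

(** A point returns to itself after as many steps as its cycle is long. *)
Lemma perm_porbits12K (n : nat) (s : 'S_n) :
  (forall C : {set 'I_n}, C \in porbits s -> #|C| = 1 \/ #|C| = 2) ->
  involutive s.
Proof.
move=> cycs i; have := iter_porbit s i.
have [|-> //= si|-> //] := cycs (porbit s i); first exact: imset_f.
by rewrite !si.
Qed.

Lemma act_bfunK (n : nat) (s : 'S_n) :
  involutive s -> involutive (@act_bfun n s).
Proof.
move=> sK g; apply/ffunP => x; rewrite !ffunE.
by congr (g _); apply/ffunP => i; rewrite !ffunE sK.
Qed.

Lemma append2_lshift (n : nat) (x : bits n) (a b : bool) (j : 'I_n) :
  append2 x a b (lshift 2 j) = x j.
Proof. by rewrite ffunE (unsplitK (inl j)). Qed.

Lemma append2_rshift (n : nat) (x : bits n) (a b : bool) (k : 'I_2) :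
  append2 x a b (rshift n k) = if k == ord0 then a else b.
Proof. by rewrite ffunE (unsplitK (inr k)). Qed.

Lemma ord2_neq0 (k : 'I_2) : k <> ord0 -> k = ord_max.
Proof. by case: k => -[|[|//]] lt_k2 k0; [case: k0|]; apply: val_inj. Qed.

Lemma append2_surj (n : nat) (y : bits (n + 2)) :
  exists x a b, y = append2 x a b.
Proof.
exists [ffun j => y (lshift 2 j)], (y (rshift n ord0)), (y (rshift n ord_max)).
apply/ffunP => i; case: (split_ordP i) => [j | k] ->.
  by rewrite append2_lshift ffunE.
rewrite append2_rshift; case: eqP => [-> // | k0].
by rewrite (ord2_neq0 _ k0).
Qed.

Lemma ple_append2 (n : nat) (x y : bits n) (a b c d : bool) :
  ple (append2 x a b) (append2 y c d) = [&& ple x y, (a <= c)%O & (b <= d)%O].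
Proof.
apply/pleP/and3P => [le_xy | [/pleP le_xy ac bd] i].
  split; last 2 first.
  - by have := le_xy (rshift n ord0); rewrite !append2_rshift.
  - by have := le_xy (rshift n ord_max); rewrite !append2_rshift.
  by apply/pleP => j; have := le_xy (lshift 2 j); rewrite !append2_lshift.
case: (split_ordP i) => [j | k] ->; first by rewrite !append2_lshift.
by rewrite !append2_rshift; case: eqP.
Qed.

(** To compare [f] at [(x, a, b) <= (y, c, d)], pass through [(y, a, b)]. *)
Lemma Dn_restr2P (n : nat) (f : bfun (n + 2)) :
  f \in Dn (n + 2) <->
  (forall a b, restr2 f a b \in Dn n) /\
  (forall a b c d, (a <= c)%O -> (b <= d)%O ->
     ple (restr2 f a b) (restr2 f c d)).
Proof.
split=> [/DnP mono | [mono_restr le_restr]].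
  split=> [a b | a b c d ac bd].
    by apply/DnP => x y xy; rewrite !ffunE mono // ple_append2 xy !lexx.
  by apply/pleP => x; rewrite !ffunE mono // ple_append2 ple_refl ac bd.
apply/DnP => u v.
have [x [a [b ->]]] := append2_surj n u.
have [y [c [d ->]]] := append2_surj n v.
rewrite ple_append2 => /and3P[xy ac bd].
have /DnP/(_ x y xy) := mono_restr a b; rewrite !ffunE => /le_trans; apply.
by have /pleP/(_ y) := le_restr a b c d ac bd; rewrite !ffunE.
Qed.

Lemma restr2_inj (n : nat) (f g : bfun (n + 2)) :
  (forall a b, restr2 f a b = restr2 g a b) -> f = g.
Proof.
move=> fg; apply/ffunP => y; have [x [a [b ->]]] := append2_surj n y.
by have /ffunP/(_ x) := fg a b; rewrite !ffunE.
Qed.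

Lemma act_bits_append2 (n : nat) (s : 'S_n) (x : bits n) (a b : bool) :
  act_bits (juxt_perm s swap2) (append2 x a b) = append2 (act_bits s x) b a.
Proof.
apply/ffunP => i; rewrite ffunE permE /juxt_fun.
case: (split_ordP i) => [j | k] ->.
  by rewrite !append2_lshift ffunE.
rewrite !append2_rshift /swap2.
by case: tpermP => [-> | -> | /ord2_neq0 ->].
Qed.

Lemma restr2_act (n : nat) (s : 'S_n) (f : bfun (n + 2)) (a b : bool) :
  restr2 (act_bfun (juxt_perm s swap2) f) a b = act_bfun s (restr2 f b a).
Proof. by apply/ffunP => x; rewrite !ffunE act_bits_append2. Qed.

Lemma fixed_restr2P (n : nat) (s : 'S_n) (f : bfun (n + 2)) :
  act_bfun (juxt_perm s swap2) f = f <->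
  forall a b, restr2 f a b = act_bfun s (restr2 f b a).
Proof.
split=> [fixf a b | fixr]; first by rewrite -restr2_act fixf.
by apply: restr2_inj => a b; rewrite restr2_act -fixr.
Qed.

Theorem mainTheorem3 (n : nat) (hn : 1 <= n) (pi : 'S_n)
    (hpi : forall C : {set 'I_n}, C \in porbits pi -> #|C| = 1 \/ #|C| = 2)
    (f : bfun (n + 2)) :
  f \in FixD (juxt_perm pi swap2) <->
  [/\ restr2 f false false \in FixD pi /\ restr2 f true true \in FixD pi,
      restr2 f true false \in Dn n /\ restr2 f false true \in Dn n,
      restr2 f true false = act_bfun pi (restr2 f false true) &
      ple (restr2 f false false) (restr2 f true false) /\
      ple (restr2 f true false) (restr2 f true true)].
Proof.
split=> [/FixDP[/Dn_restr2P[mono le_restr] /fixed_restr2P fixr] | ].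
  split; [split | by split | exact: fixr | by split; apply: le_restr].
  - by apply/FixDP; split.
  - by apply/FixDP; split.
move=> [[/FixDP[mono00 fix00] /FixDP[mono11 fix11]] [mono10 mono01] f10
        [le0010 le1011]].
have f01 : restr2 f false true = act_bfun pi (restr2 f true false).
  by rewrite f10 act_bfunK //; apply: perm_porbits12K.
have le0001 : ple (restr2 f false false) (restr2 f false true).
  by rewrite f01 -fix00; apply: act_bfun_homo.
have le0111 : ple (restr2 f false true) (restr2 f true true).
  by rewrite f01 -fix11; apply: act_bfun_homo.
apply/FixDP; split; last by apply/fixed_restr2P => -[] [].
apply/Dn_restr2P; split=> [[] [] // | ].
have le0011 := ple_trans _ _ _ _ le0010 le1011.
by move=> [] [] [] [] // _ _; apply: ple_refl.
Qed.
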